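(* Let $X\in\mathbb{R}^{(r+1)\times(k+1)}$ with $r\ge k\ge 1$. For $i\in\{1,\dots,r+1\}$ and $j\in\{1,\dots,k+1\}$ let $A_{i,j}\in\mathbb{R}^{r\times k}$ be $X$ with row $i$ and column $j$ removed. Let $(i^*,j^* )$ be a pair of indices such that $A_{i^*,j^*}$ has full column rank $k$ and $$\det(A_{i^*,j^*}^{T}A_{i^*,j^*})\ \ge\ \frac{1}{(r+1)(k+1)}\sum_{i=1}^{r+1}\sum_{j=1}^{k+1}\det(A_{i,j}^{T}A_{i,j}),$$ and let $X_{\mathrm{CUR}}$ be the CUR approximation of $X$ formed using the submatrix $A_{i^*,j^*}$. Then $$\|X_{\mathrm{CUR}}-X\|_F^2\ \le\ \frac{(r+1)(k+1)}{r+1-k}\,\lambda_{\min}(X^{T}X).$$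
   Context: $\lambda_{\min}$ denotes the smallest eigenvalue of a symmetric matrix, $\|\cdot\|_F$ the Frobenius norm, and $A^+$ the Moore–Penrose pseudoinverse of $A$. The CUR approximation of $X$ formed using $A_{i^*,j^*}$ is $$X_{\mathrm{CUR}}=X_{:,J}\,A_{i^*,j^*}^{+}\,X_{I,:},\qquad I=\{1,\dots,r+1\}\setminus\{i^*\},\quad J=\{1,\dots,k+1\}\setminus\{j^*\},$$ where $X_{:,J}$ is the submatrix of $X$ of columns indexed by $J$, $X_{I,:}$ the submatrix of rows indexed by $I$, and $A_{i^*,j^*}=X_{I,J}$. *)

(* Defs.v *)
From HB Require Import structures.
From mathcomp Require Import all_boot all_order all_algebra.
From mathcomp Require Import spectral complex polyrcf.
From mathcomp Require Export reals.

Set Implicit Arguments.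
Unset Strict Implicit.
Unset Printing Implicit Defensive.

Import Order.TTheory GRing.Theory Num.Theory.
Local Open Scope ring_scope.

Section FrobeniusNorm.
Variable R : rcfType.

Definition frobenius_norm m n (M : 'M[R]_(m, n)) : R :=
  Num.sqrt (\sum_(i < m) \sum_(j < n) M i j ^+ 2).

End FrobeniusNorm.

Section Pseudoinverse.
Variable R : realFieldType.

Definition penrose m n (A : 'M[R]_(m, n)) : pred 'M[R]_(n, m) :=
  [pred P | [&& A *m P *m A == A, P *m A *m P == P,
                (A *m P)^T == A *m P & (P *m A)^T == P *m A]].

Lemma mulmx_tr_eq0 m n (A : 'M[R]_(m, n)) : A *m A^T = 0 -> A = 0.
Proof.
move=> AA0; apply/matrixP => i j; rewrite mxE.
have: (A *m A^T) i i = 0 by rewrite AA0 mxE.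
rewrite mxE => /eqP; rewrite psumr_eq0 => [/allP/(_ j)|k _]; last first.
  by rewrite mxE -expr2 sqr_ge0.
by rewrite mem_index_enum mxE mulf_eq0 orbb => /(_ isT)/eqP.
Qed.

Lemma gram_unitmx m n (G : 'M[R]_(m, n)) : row_free G -> G *m G^T \in unitmx.
Proof.
move=> freeG; rewrite -row_free_unit -kermx_eq0.
have: kermx (G *m G^T) *m G = 0.
  by apply: mulmx_tr_eq0; rewrite trmx_mul mulmxA -(mulmxA _ G) mulmx_ker mul0mx.
by rewrite -(mul0mx _ G) => /(row_free_inj freeG) ->.
Qed.

Lemma penrose_full_rank_factors m p n (F : 'M[R]_(m, p)) (G : 'M[R]_(p, n)) :
  row_full F -> row_free G -> exists P, penrose (F *m G) P.
Proof.
move=> fullF /gram_unitmx uG.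
have uF : F^T *m F \in unitmx.
  by rewrite -{2}[F]trmxK; apply: gram_unitmx; rewrite /row_free mxrank_tr.
set H := invmx (G *m G^T) in uG *; set K := invmx (F^T *m F) in uF *.
have AP : F *m G *m (G^T *m H *m K *m F^T) = F *m K *m F^T.
  by rewrite -!mulmxA (mulmxA G) (mulmxA (G *m _)) mulmxV // mul1mx.
have PA : (G^T *m H *m K *m F^T) *m (F *m G) = G^T *m H *m G.
  by rewrite -!mulmxA (mulmxA F^T) (mulmxA K) mulVmx // mul1mx.
have trH : H^T = H by rewrite trmx_inv trmx_mul trmxK.
have trK : K^T = K by rewrite trmx_inv trmx_mul trmxK.
exists (G^T *m H *m K *m F^T); apply/and4P; split; apply/eqP.
- by rewrite AP -!mulmxA (mulmxA F^T) (mulmxA K) mulVmx // mul1mx.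
- by rewrite PA -!mulmxA (mulmxA G) (mulmxA (G *m _)) mulmxV // mul1mx.
- by rewrite AP !trmx_mul trmxK trK mulmxA.
- by rewrite PA !trmx_mul trmxK trH mulmxA.
Qed.

Lemma penrose_exists m n (A : 'M[R]_(m, n)) : exists P, penrose A P.
Proof.
have := penrose_full_rank_factors (col_base_full A) (row_base_free A).
by rewrite mulmx_base.
Qed.

(* The Moore-Penrose pseudoinverse: the unique solution (see [penrose_uniq]) of
   the four Penrose equations. *)
Definition mpinv m n (A : 'M[R]_(m, n)) : 'M[R]_(n, m) :=
  xchoose (penrose_exists A).

Lemma mpinvP m n (A : 'M[R]_(m, n)) : penrose A (mpinv A).
Proof. exact: xchooseP. Qed.

Lemma penrose_uniq m n (A : 'M[R]_(m, n)) P Q :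
  penrose A P -> penrose A Q -> P = Q.
Proof.
move=> /and4P[/eqP p1 /eqP p2 /eqP p3 /eqP p4].
move=> /and4P[/eqP q1 /eqP q2 /eqP q3 /eqP q4].
have APQ : A *m P = A *m Q.
  transitivity ((A *m Q)^T *m (A *m P)^T); first by rewrite q3 p3 mulmxA q1.
  by rewrite -trmx_mul mulmxA p1.
have PAQ : P *m A = Q *m A.
  transitivity ((P *m A)^T *m (Q *m A)^T).
    by rewrite q4 p4 -mulmxA (mulmxA A) q1.
  by rewrite -trmx_mul -mulmxA (mulmxA A) p1.
by rewrite -p2 -mulmxA APQ mulmxA PAQ q2.
Qed.

End Pseudoinverse.

Section SmallestEigenvalue.
Variable R : rcfType.

(* [rootsR p] is the increasing list of the roots of [p] in [R], so this is
   the smallest eigenvalue whenever [M] has one; see [lambda_minP] and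
   [symmetric_eigenvalue]. *)
Definition lambda_min n (M : 'M[R]_n) : R := head 0 (rootsR (char_poly M)).

Lemma lambda_minP n (M : 'M[R]_n) a : eigenvalue M a ->
  eigenvalue M (lambda_min M) /\
  (forall b, eigenvalue M b -> lambda_min M <= b).
Proof.
have p0 : char_poly M != 0 by rewrite monic_neq0 ?char_poly_monic.
have memE b : (b \in rootsR (char_poly M)) = eigenvalue M b.
  by rewrite eigenvalue_root_char -(roots_on_rootsR p0) inE.
have := sorted_roots (- cauchy_bound (char_poly M))
  (cauchy_bound (char_poly M)) (char_poly M).
rewrite -/(rootsR _) -memE /lambda_min.
case: (rootsR _) memE => [//|x s] memE /= srt _; split.
  by rewrite -memE mem_head.
move=> b; rewrite -memE inE => /orP[/eqP-> //|bs].
by apply/ltW; move: (order_path_min lt_trans srt) => /allP; apply.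
Qed.

Lemma symmetric_eigenvalue n (M : 'M[R]_n.+1) : M^T = M ->
  exists a, eigenvalue M a.
Proof.
move=> symM; pose f := real_complex R.
have [a /eigenvalueP[v vM v0]] := eigenvalue_closed (map_mx f M) isT.
pose w := map_mx Num.conj v.
have fconj x : Num.conj (f x) = f x by apply/CrealP/complex_realP; exists x.
have wM : map_mx f M *m w^T = Num.conj a *: w^T.
  have /(congr1 (fun u => (map_mx Num.conj u)^T)) := vM.
  rewrite map_mxM map_mxZ trmx_mul linearZ /= => <-.
  by congr (_ *m _); apply/matrixP => i j; rewrite !mxE fconj -[in LHS]symM mxE.
have vw0 : (v *m w^T) 0 0 != 0.
  apply: contraNneq v0; rewrite mxE => /eqP; rewrite psumr_eq0 => [/allP vv0|k _].
    apply/eqP/rowP => k; rewrite mxE; have := vv0 k (mem_index_enum _).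
    by rewrite !mxE -normCK sqrf_eq0 normr_eq0 => /eqP.
  by rewrite !mxE -normCK exprn_ge0.
have aR : a \is Num.real.
  apply/CrealP; apply: (mulIf vw0).
  have: v *m (map_mx f M *m w^T) = v *m map_mx f M *m w^T by rewrite mulmxA.
  by rewrite wM vM -scalemxAr -scalemxAl => /matrixP/(_ 0 0); rewrite !mxE.
have /complex_realP[x ax] := aR.
exists x; rewrite eigenvalue_root_char -(fmorph_root f) map_char_poly.
by rewrite -eigenvalue_root_char; apply/eigenvalueP; exists v => //; rewrite [LHS]vM ax.
Qed.

End SmallestEigenvalue.

Section CUR.
Variable R : realFieldType.

Definition submx_del r k (X : 'M[R]_(r.+1, k.+1)) i j : 'M[R]_(r, k) :=
  row' i (col' j X).

(* [i] and [j] are the deleted row and column: the row and column index sets of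
   the approximation are their complements. *)
Definition cur_approx r k (X : 'M[R]_(r.+1, k.+1)) i j : 'M[R]_(r.+1, k.+1) :=
  col' j X *m mpinv (submx_del X i j) *m row' i X.

End CUR.

(* Main.v *)
Require Import Defs.
From mathcomp Require Import all_boot all_order all_algebra.
From mathcomp Require Import ring.
Set Implicit Arguments.
Unset Strict Implicit.
Unset Printing Implicit Defensive.
Import Order.TTheory GRing.Theory Num.Theory.
Local Open Scope ring_scope.

(** Write [A] for the chosen submatrix, [M] for [X] without column [jstar],
    [x] for that column, and [S = X^T X].

    Since [A] has full column rank, [A^+ A = 1], so the approximation
    reproduces every column of [X] but [x], and its error is the single column
    [w = x - M y] with [y = A^+ (x without entry istar)]
    ([frobenius_cur_approx]).  This [w] is the residual of a least-squares fit
    of [x] by the columns of [M] in which row [istar] was ignored.  The true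
    least-squares residual [q] satisfies [det S = det (M^T M) |q|^2]
    (base times height, [det_gram_dist]).  Ignoring one row enlarges
    the residual by at most the factor that separates [det (M^T M)] from
    [det (A^T A)]:
    [det (A^T A) |w|^2 <= det S] ([det_gram_residual]).

    It remains to compare [det S] with [det (A^T A)].  Summed over the deleted
    row, the Gram determinants give [(r + 1 - k) det (M_j^T M_j)], where [M_j]
    is [X] without column [j] ([sum_det_gram_row']), because each [k]-minor of
    [M_j] avoids exactly [r + 1 - k] rows.  Hence the hypothesis on [A] reads
    [(r + 1 - k) T <= (r + 1) (k + 1) det (A^T A)] with
    [T = \sum_j det (M_j^T M_j) = \tr (\adj S)].  For nonsingular
    [S], [det S / T] is the inverse of the sum of the inverse eigenvalues, so
    [det S <= lambda T] for every eigenvalue [lambda]; for singular [S] this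
    holds because [lambda] and [T] are nonnegative ([det_gram_le_eigenvalue]).
    Chaining, [det (A^T A) |w|^2 <= det S <= lambda T], and dividing by [det (A^T A) > 0]
    gives the bound. *)

(** * Rank-one updates *)

(** The matrix determinant lemma: the two factorisations of the same bordered
    matrix are its block LU and block UL decompositions. *)
Lemma det_add_rank1 (R : comUnitRingType) n (G : 'M[R]_n) (u : 'cV_n)
    (v : 'rV_n) :
  G \in unitmx ->
  \det (G + u *m v) = \det G * (1 + (v *m invmx G *m u) 0 0).
Proof.
move=> uG; pose B : 'M_(1 + n) := block_mx 1%:M (- v) u G.
have eqL : B = block_mx 1%:M 0 u 1%:M *m block_mx 1%:M (- v) 0 (G + u *m v).
  rewrite mulmx_block ?(mul1mx, mulmx1, mul0mx, mulmx0, addr0, add0r).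
  by rewrite mulmxN addrCA addNr addr0.
have eqR : B = block_mx (1%:M + v *m invmx G *m u) (- v) 0 G
                 *m block_mx 1%:M 0 (invmx G *m u) 1%:M.
  rewrite mulmx_block ?(mul1mx, mulmx1, mul0mx, mulmx0, addr0, add0r).
  by rewrite mulNmx !mulmxA mulmxV // mul1mx addrK.
have := congr1 determinant eqL; rewrite {1}eqR !det_mulmx.
rewrite !det_lblock !det_ublock !det1 !(mul1r, mulr1) => <-.
by rewrite mulrC det_mx11 !mxE.
Qed.

(** Deleting a row changes the Gram matrix by a rank-one term, which is what
    makes the matrix determinant lemma applicable to row deletions. *)
Lemma gram_row' (R : comNzRingType) m n (M : 'M[R]_(m.+1, n)) i :
  (row' i M)^T *m row' i M + (row i M)^T *m row i M = M^T *m M.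
Proof.
apply/matrixP=> a b; rewrite !mxE (bigD1_ord i) //= big_ord1 addrC.
by rewrite !mxE; congr (_ + _); apply: eq_bigr => l _; rewrite !mxE.
Qed.

(** * Gram determinants *)

Section Gram.
Variable R : realFieldType.
Implicit Types m n : nat.

Lemma sqnormE m (w : 'cV[R]_m) : (w^T *m w) 0 0 = \sum_i w i 0 ^+ 2.
Proof. by rewrite mxE; apply: eq_bigr => i _; rewrite mxE expr2. Qed.

Lemma sqnorm_ge0 m (w : 'cV[R]_m) : 0 <= (w^T *m w) 0 0.
Proof. by rewrite sqnormE sumr_ge0 // => i _; rewrite sqr_ge0. Qed.

Lemma sqnorm_gt0 m (v : 'rV[R]_m) : v != 0 -> 0 < (v *m v^T) 0 0.
Proof.
move=> v0; have := sqnorm_ge0 v^T; rewrite trmxK le_eqVlt => /orP[/eqP vv0|//].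
case/eqP: v0; apply: mulmx_tr_eq0.
by rewrite [LHS]mx11_scalar -vv0 raddf0.
Qed.

Lemma unitmx_gram m n (M : 'M[R]_(m, n)) :
  (M^T *m M \in unitmx) = (\rank M == n).
Proof.
apply/idP/idP => [|rM]; last first.
  by rewrite -{2}[M]trmxK; apply: gram_unitmx; rewrite /row_free mxrank_tr.
rewrite -row_free_unit /row_free => /eqP rG.
by rewrite eqn_leq rank_leq_col -{1}rG mxrankM_maxr.
Qed.

Lemma det_gram_eq0 m n (M : 'M[R]_(m, n)) :
  (\det (M^T *m M) == 0) = (\rank M != n).
Proof. by rewrite -unitmx_gram unitmxE unitfE negbK. Qed.

(** Cauchy-Binet gives this by counting the rows missed by each minor.  Here,
    when [G = M^T M] is invertible, deleting row [m_i] multiplies [det G] by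
    [1 - m_i G^-1 m_i^T], and the subtracted terms sum to
    [tr (G^-1 M^T M) = n].  When [G] is singular, both sides vanish. *)
Lemma sum_det_gram_row' m n (M : 'M[R]_(m.+1, n)) :
  \sum_i \det ((row' i M)^T *m row' i M)
    = (m.+1%:R - n%:R) * \det (M^T *m M).
Proof.
have [rM|] := eqVneq (\rank M) n; last first.
  rewrite -det_gram_eq0 => dM0; rewrite (eqP dM0) mulr0 big1 // => i _.
  apply/eqP; rewrite det_gram_eq0.
  apply: contraTneq dM0 => ri; rewrite det_gram_eq0 negbK eqn_leq rank_leq_col.
  by rewrite -{1}ri row'Esub mxrankS // rowsub_sub.
set G := M^T *m M; have uG : G \in unitmx by rewrite unitmx_gram rM.
have -> : m.+1%:R - n%:R = \sum_i (1 - (M *m invmx G *m M^T) i i) :> R.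
  rewrite sumrB sumr_const card_ord.
  by rewrite -/(\tr (M *m _ *m _)) mxtrace_mulC mulmxA mulmxV // mxtrace1.
rewrite mulrC mulr_sumr; apply: eq_bigr => i _.
have -> : (row' i M)^T *m row' i M = G + (- (row i M)^T) *m row i M.
  by rewrite /G -(gram_row' _ i) mulNmx addrK.
rewrite det_add_rank1 //; congr (_ * (1 + _)).
by rewrite mulmxN mxE tr_row -!row_mul mxE colE mulmxA -colE mxE.
Qed.

(** Induction on the number of rows: a tall matrix has, up to a positive factor,
    the sum of the Gram determinants of its row deletions; the Gram determinant
    of a square matrix is a square, and that of a wide one vanishes. *)
Lemma det_gram_ge0 m n (M : 'M[R]_(m, n)) : 0 <= \det (M^T *m M).
Proof.
have wide p (N : 'M[R]_(p, n)) : (p < n)%N -> 0 <= \det (N^T *m N).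
  move=> pn; suff /eqP-> : \det (N^T *m N) == 0 by [].
  by rewrite det_gram_eq0 neq_ltn (leq_ltn_trans (rank_leq_row _)).
elim: m M => [|m IHm] M.
  by case: n M wide => [|n] M wide; [rewrite det_mx00 ler01 | apply: wide].
case: (ltngtP n m.+1) => [nm | /wide // | nm].
  have: 0 <= (m.+1%:R - n%:R) * \det (M^T *m M).
    by rewrite -sum_det_gram_row' sumr_ge0.
  by rewrite pmulr_rge0 // subr_gt0 ltr_nat.
by case: _ / nm M wide IHm => M _ _; rewrite det_mulmx det_tr -expr2 sqr_ge0.
Qed.

Lemma adj_gram_diag m n (X : 'M[R]_(m, n.+1)) j :
  \adj (X^T *m X) j j = \det ((col' j X)^T *m col' j X).
Proof.
rewrite mxE /cofactor -signr_odd oddD addbb mul1r; congr (\det _).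
by apply/matrixP=> a b; rewrite !mxE; apply: eq_bigr => l _; rewrite !mxE.
Qed.

(** Base times height.  As [q] is orthogonal to all columns but the [j]-th,
    [X^T X z = X^T q] is [|q|^2] times the [j]-th basis vector; multiplying by
    the adjugate and reading off entry [j] gives the identity.  Taking [z] as
    data spares moving column [j] to the end. *)
Lemma det_gram_dist m n (X : 'M[R]_(m, n.+1)) j (z : 'cV_n.+1) (q : 'cV_m) :
    z j 0 = 1 -> X *m z = q -> (col' j X)^T *m q = 0 ->
  \det (X^T *m X) = \det ((col' j X)^T *m col' j X) * (q^T *m q) 0 0.
Proof.
move=> zj Xz Mq; set S := X^T *m X.
have Xtq l : l != j -> (X^T *m q) l 0 = 0.
  case: (unliftP j l) => [l' -> _ |->]; last by rewrite eqxx.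
  have /matrixP/(_ l' 0) := Mq; rewrite !mxE => Mql.
  by rewrite -[RHS]Mql; apply: eq_bigr => p _; rewrite !mxE.
have qq : (q^T *m q) 0 0 = (X^T *m q) j 0.
  rewrite -{1}Xz trmx_mul -mulmxA mxE (bigD1 j) //= big1 => [|l lj].
    by rewrite addr0 mxE zj mul1r.
  by rewrite Xtq // mulr0.
have : (\adj S *m (S *m z)) j 0 = \det S.
  by rewrite mulmxA mul_adj_mx mul_scalar_mx mxE zj mulr1.
rewrite {1}/S -mulmxA Xz mxE (bigD1 j) //= big1 => [|l lj]; last first.
  by rewrite Xtq // mulr0.
by rewrite addr0 adj_gram_diag -qq.
Qed.

Lemma col'_sub_col m n (X : 'M[R]_(m, n.+1)) j (y : 'cV_n) :
  exists z : 'cV_n.+1, z j 0 = 1 /\ X *m z = col j X - col' j X *m y.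
Proof.
exists (\col_l if unlift j l is Some l' then - y l' 0 else 1).
split; first by rewrite mxE unlift_none.
apply/colP=> i; rewrite !mxE (bigD1_ord j) //= !mxE unlift_none mulr1.
congr (_ + _); rewrite -sumrN; apply: eq_bigr => l _.
by rewrite !mxE liftK mulrN.
Qed.

(** With [c] the deleted row of [M], [H = (A^T A)^-1], [s = c H c^T >= 0] and
    [f] entry [i] of [w], the matrix determinant lemma gives
    [det (M^T M) = (1 + s) det (A^T A)], and the distance from column [j] to the
    span of the others satisfies [|q|^2 = |w|^2 - f^2 s / (1 + s)].  Their
    product is [det (A^T A) (|w|^2 + s (|w|^2 - f^2))], where [f^2 <= |w|^2]. *)
Lemma det_gram_residual m n (X : 'M[R]_(m.+1, n.+1)) i j (y : 'cV_n) :
    let A := row' i (col' j X) in let w := col j X - col' j X *m y in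
    \rank A = n -> A^T *m row' i w = 0 ->
  \det (A^T *m A) * (w^T *m w) 0 0 <= \det (X^T *m X).
Proof.
move=> A w rA Aw; have wE : w = col j X - col' j X *m y by [].
clearbody w; set M := col' j X; set c := row i M.
have uA : A^T *m A \in unitmx by rewrite unitmx_gram rA.
have a_ge0 := det_gram_ge0 A.
set H := invmx (A^T *m A); set t := H *m c^T; set s := (c *m t) 0 0.
have ct : c *m t = s%:M by rewrite [LHS]mx11_scalar.
have s_ge0 : 0 <= s.
  have -> : s = ((A *m t)^T *m (A *m t)) 0 0; last exact: sqnorm_ge0.
  have HT : H^T = H by rewrite /H trmx_inv trmx_mul trmxK.
  rewrite trmx_mul -mulmxA (mulmxA A^T) /t (mulmxA _ H) mulmxV // mul1mx.
  by rewrite trmx_mul HT trmxK -mulmxA.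
set f := w i 0.
have Mw : M^T *m w = f *: c^T.
  apply/colP=> l; have /colP/(_ l) := Aw.
  rewrite [LHS]mxE [RHS]mxE => Awl; rewrite mxE (bigD1_ord i) //=.
  rewrite [X in _ + X](_ : _ = 0) ?addr0 => [|]; last first.
    by rewrite -[RHS]Awl; apply: eq_bigr => p _; rewrite !mxE.
  by rewrite !mxE mulrC.
have GM : M^T *m M = A^T *m A + c^T *m c by rewrite -(gram_row' M i).
have detM : \det (M^T *m M) = \det (A^T *m A) * (1 + s).
  by rewrite GM det_add_rank1 // -mulmxA.
have s1 : 1 + s != 0 by rewrite gt_eqF // ltr_wpDr.
(* [t] is an eigenvector of [H M^T M] for the eigenvalue [1 + s], so the normal
   equations [M^T q = 0] are solved by a multiple of [M t]. *)
set q := w - (f / (1 + s)) *: (M *m t).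
have Mq : M^T *m q = 0.
  rewrite mulmxBr Mw -scalemxAr mulmxA GM mulmxDl {1}/t (mulmxA _ H) mulmxV //.
  rewrite mul1mx -mulmxA ct mul_mx_scalar -{2}[c^T]scale1r -scalerDl scalerA.
  by rewrite divfK // subrr.
have qq : (q^T *m q) 0 0 = (w^T *m w) 0 0 - f ^+ 2 * s / (1 + s).
  have -> : q^T *m q = w^T *m q.
    have -> : q^T = w^T - (f / (1 + s)) *: (M *m t)^T.
      by rewrite linearB linearZ.
    rewrite mulmxBl -scalemxAl trmx_mul -mulmxA Mq.
    by rewrite mulmx0 scaler0 subr0.
  have -> : w^T *m q = w^T *m w - (f ^+ 2 / (1 + s)) *: (c *m t).
    have wM : w^T *m M = f *: c.
      by rewrite -[M]trmxK -trmx_mul Mw linearZ /= trmxK.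
    rewrite mulmxBr -scalemxAr mulmxA wM -scalemxAl scalerA.
    by congr (_ - _ *: _); rewrite expr2 mulrAC.
  by rewrite ct !mxE eqxx mulr1n mulrAC.
have [z [zj Xz]] : exists z : 'cV_n.+1, z j 0 = 1 /\ X *m z = q.
  have [z [zj Xz]] := col'_sub_col X j (y + (f / (1 + s)) *: t).
  exists z; split=> //; rewrite Xz /q wE mulmxDr -scalemxAr opprD addrA //.
rewrite (det_gram_dist zj Xz Mq) -/M detM qq -mulrA ler_wpM2l //.
have f_le : f ^+ 2 <= (w^T *m w) 0 0.
  rewrite sqnormE (bigD1 i) //= lerDl sumr_ge0 // => l _; exact: sqr_ge0.
have -> : (1 + s) * ((w^T *m w) 0 0 - f ^+ 2 * s / (1 + s))
  = (w^T *m w) 0 0 + s * ((w^T *m w) 0 0 - f ^+ 2) by field.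
by rewrite lerDl mulr_ge0 // subr_ge0.
Qed.

(** * The bound by an eigenvalue *)

(** Cauchy-Schwarz for all columns of [N] at once: with [a = |v|^2] and [K]
    equal to [a] times the projection of [N] orthogonally to [v],
    [tr (K K^T) >= 0] is [a] times the difference of the two sides. *)
Lemma sqnorm_mulmx_le m n (v : 'rV[R]_m) (N : 'M[R]_(m, n)) :
  v != 0 ->
  (v *m N *m (v *m N)^T) 0 0 <= (v *m v^T) 0 0 * \tr (N *m N^T).
Proof.
move=> v0; set a := (v *m v^T) 0 0; set b := _ 0 0.
have aE : v *m v^T = a%:M by rewrite [LHS]mx11_scalar.
have bE : v *m N *m (v *m N)^T = b%:M by rewrite [LHS]mx11_scalar.
have a_gt0 : 0 < a by exact: sqnorm_gt0.
pose K := a *: N - v^T *m (v *m N).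
have: 0 <= \tr (K *m K^T).
  rewrite sumr_ge0 // => i _; rewrite mxE sumr_ge0 // => j _.
  by rewrite [_^T _ _]mxE -expr2 sqr_ge0.
suff -> : \tr (K *m K^T) = a * (a * \tr (N *m N^T) - b).
  by rewrite pmulr_rge0 // subr_ge0.
have KT : K^T = a *: N^T - (v *m N)^T *m v.
  by rewrite linearB linearZ /= trmx_mul trmxK.
rewrite KT mulmxBr !mulmxBl -!scalemxAl -!scalemxAr.
rewrite !linearB /= !mxtraceZ.
have tr1 : \tr (N *m ((v *m N)^T *m v)) = b.
  by rewrite mulmxA mxtrace_mulC mulmxA bE mxtrace_scalar.
have tr2 : \tr (v^T *m (v *m N) *m N^T) = b.
  by rewrite -mulmxA mxtrace_mulC -(mulmxA _ N^T) -trmx_mul bE mxtrace_scalar.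
have tr3 : \tr (v^T *m (v *m N) *m ((v *m N)^T *m v)) = a * b.
  move: bE; set u := v *m N => bE.
  rewrite mxtrace_mulC -mulmxA (mulmxA v) aE mul_scalar_mx -scalemxAr mxtraceZ.
  by rewrite mxtrace_mulC bE mxtrace_scalar.
by rewrite tr1 tr2 tr3; ring.
Qed.

Lemma gram_eigenvalue_ge0 m n (X : 'M[R]_(m, n)) a :
  eigenvalue (X^T *m X) a -> 0 <= a.
Proof.
move=> /eigenvalueP[v vS v0]; rewrite -(pmulr_lge0 _ (sqnorm_gt0 v0)).
have -> : a * (v *m v^T) 0 0 = ((X *m v^T)^T *m (X *m v^T)) 0 0.
  by rewrite trmx_mul trmxK -mulmxA (mulmxA X^T) mulmxA vS -scalemxAl [RHS]mxE.
exact: sqnorm_ge0.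
Qed.

(** The sum is [tr (\adj S)], i.e. [det S * tr (S^-1)] when [S = X^T X] is
    invertible, so the claim reduces to [1 <= a tr (S^-1)].  This follows from
    [|v|^2 = a v S^-1 v^T <= a |v|^2 tr (S^-1)] for an eigenvector [v]; the
    factorisation [S^-1 = N N^T] brings this under [sqnorm_mulmx_le].  When [S]
    is singular, the right-hand side is nonnegative. *)
Lemma det_gram_le_eigenvalue m n (X : 'M[R]_(m, n.+1)) a :
  eigenvalue (X^T *m X) a ->
  \det (X^T *m X) <= a * \sum_j \det ((col' j X)^T *m col' j X).
Proof.
move=> eig_a; have a_ge0 := gram_eigenvalue_ge0 eig_a.
have [-> | detS0] := eqVneq (\det (X^T *m X)) 0.
  by rewrite mulr_ge0 // sumr_ge0 // => j _; apply: det_gram_ge0.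
case/eigenvalueP: eig_a => v; move: detS0 (det_gram_ge0 X).
set S := X^T *m X => detS0 detS_ge0 vS v0.
have uS : S \in unitmx by rewrite unitmxE unitfE.
have adjE : \adj S = \det S *: invmx S.
  by rewrite /invmx uS scalerA mulfV // scale1r.
pose N := invmx S *m X^T.
have NN : N *m N^T = invmx S.
  have ST : S^T = S by rewrite /S trmx_mul trmxK.
  rewrite /N trmx_mul trmxK trmx_inv ST -mulmxA (mulmxA X^T).
  by rewrite mulmxV // mulmx1.
have -> : \sum_j \det ((col' j X)^T *m col' j X) = \det S * \tr (N *m N^T).
  rewrite NN -mxtraceZ -adjE.
  by apply: eq_bigr => j _; rewrite adj_gram_diag.
rewrite mulrCA ler_peMr // -(ler_pM2l (sqnorm_gt0 v0)) mulr1 mulrCA.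
have vv : (v *m v^T) 0 0 = a * (v *m N *m (v *m N)^T) 0 0.
  rewrite trmx_mul -mulmxA (mulmxA N) NN mulmxA.
  transitivity ((a *: (v *m invmx S *m v^T)) 0 0); last by rewrite mxE.
  by rewrite !scalemxAl -vS mulmxK.
by rewrite {1}vv ler_wpM2l // sqnorm_mulmx_le.
Qed.

End Gram.

(** * The error of a CUR approximation *)

(** Only column [j] of the error can be nonzero, because [A^+ A = 1].  The normal
    equations for the rows other than [i] come from [A A^+] being symmetric. *)
Lemma frobenius_cur_approx (R : rcfType) r k (X : 'M[R]_(r.+1, k.+1)) i j :
    \rank (submx_del X i j) = k ->
  exists y, let w := col j X - col' j X *m y in
    (submx_del X i j)^T *m row' i w = 0 /\
    frobenius_norm (cur_approx X i j - X) ^+ 2 = (w^T *m w) 0 0.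
Proof.
rewrite /cur_approx; set A := submx_del X i j => rA.
have /and4P[/eqP APA _ /eqP AP _] := mpinvP A.
set P := mpinv A in APA AP *; set M := col' j X.
have uA : A^T *m A \in unitmx by rewrite unitmx_gram rA.
have PA : P *m A = 1%:M.
  by rewrite -[LHS](mulKmx uA) -(mulmxA A^T) (mulmxA A) APA mulVmx.
pose b := col j (row' i X); exists (P *m b).
set w := col j X - M *m (P *m b); split.
  have -> : row' i w = b - A *m (P *m b).
    apply/colP=> l; rewrite !mxE; congr (_ - _).
    by apply: eq_bigr => p _; rewrite !mxE.
  by rewrite mulmxBr !mulmxA -(mulmxA A^T) -AP -trmx_mul APA subrr.
rewrite sqr_sqrtr; last first.
  by apply: sumr_ge0 => l _; apply: sumr_ge0 => c _; apply: sqr_ge0.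
rewrite sqnormE; apply: eq_bigr => l _.
have curE c : (M *m P *m row' i X - X) l c
              = (M *m (P *m col c (row' i X)) - col c X) l 0.
  by rewrite mulmxA [LHS]mxE [RHS]mxE !colE !mulmxA -!colE !mxE.
rewrite (bigD1_ord j) //= big1 ?addr0 => [|c _]; rewrite curE.
  by rewrite /w -(opprB (M *m _)) [in RHS]mxE sqrrN.
have -> : col (lift j c) (row' i X) = col c A.
  by apply/colP=> p; rewrite !mxE.
by rewrite colE (mulmxA P) PA mul1mx -colE !mxE subrr expr0n.
Qed.

Theorem proposition7 (R : realType) (r k : nat) (hk : (1 <= k)%N)
    (hkr : (k <= r)%N) (X : 'M[R]_(r.+1, k.+1))
    (istar : 'I_r.+1) (jstar : 'I_k.+1)
    (hrank : \rank (submx_del X istar jstar) = k)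
    (hdet : 1 / ((r.+1)%:R * (k.+1)%:R) *
              (\sum_(i < r.+1) \sum_(j < k.+1)
                 \det ((submx_del X i j)^T *m submx_del X i j))
            <= \det ((submx_del X istar jstar)^T *m submx_del X istar jstar)) :
  frobenius_norm (cur_approx X istar jstar - X) ^+ 2
    <= (r.+1)%:R * (k.+1)%:R / ((r.+1)%:R - k%:R) * lambda_min (X^T *m X).
Proof.
have [y [Aw ->]] := frobenius_cur_approx hrank.
have le_det := det_gram_residual hrank Aw.
have symS : (X^T *m X)^T = X^T *m X by rewrite trmx_mul trmxK.
have [_ /lambda_minP[eig _]] := symmetric_eigenvalue symS.
have le_lambda := le_trans le_det (det_gram_le_eigenvalue eig).
have lambda_ge0 := gram_eigenvalue_ge0 eig.
have detA_gt0 :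
    0 < \det ((submx_del X istar jstar)^T *m submx_del X istar jstar).
  by rewrite lt_neqAle eq_sym det_gram_eq0 hrank eqxx det_gram_ge0.
have d_gt0 : 0 < r.+1%:R - k%:R :> R by rewrite subr_gt0 ltr_nat ltnS.
have rk_gt0 : 0 < r.+1%:R * k.+1%:R :> R by rewrite mulr_gt0 ?ltr0Sn.
move: hdet; rewrite exchange_big /=.
under eq_bigr => j _ do rewrite sum_det_gram_row'.
rewrite -mulr_sumr mul1r mulrC ler_pdivrMr // => hT.
rewrite -(ler_pM2l detA_gt0); apply: le_trans le_lambda _.
rewrite -(ler_pM2l d_gt0) mulrCA.
apply: le_trans (ler_wpM2l lambda_ge0 hT) _.
move: (r.+1%:R - k%:R) d_gt0 => d /lt0r_neq0 d_neq0.
by rewrite le_eqVlt; apply/orP; left; apply/eqP; field.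
Qed.
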